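(* Let $d\ge 1$ and let $\mathrm{E}:\mathbb{C}^{d\times d}\to\mathbb{R}$ be $\mathrm{E}(A)=\|AA^*-A^*A\|^2$, with negative gradient flow $\mathcal{F}$. There exist constants $\epsilon,c>0$ such that, for every $A_0\in\mathbb{C}^{d\times d}$ with $\mathrm{E}(A_0)<\epsilon$, the limit $A_\infty=\lim_{t\to\infty}\mathcal{F}(A_0,t)$ satisfies $$\|A_0-A_\infty\|\le\frac{4}{c}\,\mathrm{E}(A_0)^{1/4}.$$
   Context: $\mathbb{C}^{d\times d}$ is regarded as a real inner product space with $\langle A,B\rangle=\mathrm{Re}\,\mathrm{tr}(B^*A)$; $\|\cdot\|$ is the Frobenius norm, $\|B\|^2=\sum_{i,j}|b_{ij}|^2$. The negative gradient flow $\mathcal{F}:\mathbb{C}^{d\times d}\times[0,\infty)\to\mathbb{C}^{d\times d}$ is defined by $\mathcal{F}(A_0,0)=A_0$ and $\frac{d}{dt}\mathcal{F}(A_0,t)=-\nabla\mathrm{E}(\mathcal{F}(A_0,t))$, with $\nabla$ the gradient with respect to $\langle\cdot,\cdot\rangle$; the limit $A_\infty$ exists for every $A_0$. *)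

(* Defs.v *)
From HB Require Import structures.
From mathcomp Require Import all_boot all_order all_algebra.
From mathcomp Require Import complex.
From mathcomp Require Import all_classical all_reals all_analysis.

Set Implicit Arguments.
Unset Strict Implicit.
Unset Printing Implicit Defensive.

Import Order.TTheory GRing.Theory Num.Theory.
Import numFieldNormedType.Exports.

Local Open Scope ring_scope.
Local Open Scope sesquilinear_scope.
Local Open Scope classical_set_scope.

(* The alias is what carries the *real* vector space structure and the
   Frobenius norm: 'M[R[i]]_d itself is a complex module with the max norm. *)
Definition cmx (R : realType) (d : nat) : Type := 'M[R[i]]_d.

HB.instance Definition _ (R : realType) (d : nat) :=
  GRing.Zmodule.copy (cmx R d) 'M[R[i]]_d.

Section CmxNormed.
Variables (R : realType) (d : nat).
Implicit Types (A B C : cmx R d) (k l : R).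

Definition cmx_scale k A : cmx R d := k%:C%C *: A.

Lemma cmx_scaleA k l A :
  cmx_scale k (cmx_scale l A) = cmx_scale (k * l) A.
Proof. by rewrite /cmx_scale scalerA -rmorphM. Qed.

Lemma cmx_scale1 : left_id 1 cmx_scale.
Proof. by move=> A; rewrite /cmx_scale scale1r. Qed.

Lemma cmx_scaleDr : right_distributive cmx_scale +%R.
Proof. by move=> k A B; rewrite /cmx_scale scalerDr. Qed.

Lemma cmx_scaleDl A : {morph cmx_scale^~ A : k l / k + l}.
Proof. by move=> k l; rewrite /cmx_scale rmorphD scalerDl. Qed.

HB.instance Definition _ := GRing.Zmodule_isLmodule.Build R (cmx R d)
  cmx_scaleA cmx_scale1 cmx_scaleDr cmx_scaleDl.

Definition cmx_inner A B : R :=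
  complex.Re (\tr (B^t* *m A)).

Definition frobenius A : R :=
  Num.sqrt (\sum_i \sum_j Normc.normc (A i j) ^+ 2).

Lemma frobenius_sqr A :
  frobenius A ^+ 2 = \sum_i \sum_j Normc.normc (A i j) ^+ 2.
Proof.
by rewrite sqr_sqrtr// sumr_ge0// => i _; apply: sumr_ge0 => j _; exact: sqr_ge0.
Qed.

Lemma cmx_innerE A B : cmx_inner A B =
  \sum_i \sum_j (complex.Re (A i j) * complex.Re (B i j)
               + complex.Im (A i j) * complex.Im (B i j)).
Proof.
rewrite /cmx_inner /mxtrace exchange_big/=.
rewrite (raddf_sum (@complex.Re R : Rcomplex R -> R)); apply: eq_bigr => j _.
rewrite mxE (raddf_sum (@complex.Re R : Rcomplex R -> R)); apply: eq_bigr => i _.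
rewrite !mxE; case: (A i j) => a b; case: (B i j) => a' b' /=.
by rewrite mulNr opprK mulrC [b' * b]mulrC.
Qed.

Lemma cmx_innerC A B : cmx_inner A B = cmx_inner B A.
Proof.
rewrite !cmx_innerE; apply: eq_bigr => i _; apply: eq_bigr => j _.
by rewrite mulrC [X in _ + X]mulrC.
Qed.

Lemma cmx_innerDl A B C : cmx_inner (A + B) C = cmx_inner A C + cmx_inner B C.
Proof. by rewrite /cmx_inner mulmxDr mxtraceD raddfD. Qed.

Lemma cmx_innerZl k A B : cmx_inner (k *: A) B = k * cmx_inner A B.
Proof.
rewrite !cmx_innerE mulr_sumr; apply: eq_bigr => i _.
rewrite mulr_sumr; apply: eq_bigr => j _; rewrite mxE.
by case: (A i j) => a b /=; rewrite !mul0r subr0 addr0 mulrDr !mulrA.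
Qed.

Lemma frobenius_inner A : frobenius A ^+ 2 = cmx_inner A A.
Proof.
rewrite frobenius_sqr cmx_innerE; apply: eq_bigr => i _; apply: eq_bigr => j _.
by case: (A i j) => a b /=; rewrite sqr_sqrtr ?addr_ge0 ?sqr_ge0// -!expr2.
Qed.

Lemma frobenius_ge0 A : 0 <= frobenius A.
Proof. exact: sqrtr_ge0. Qed.

Lemma frobenius_eq0 A : frobenius A = 0 -> A = 0.
Proof.
move=> A0; have := frobenius_sqr A; rewrite A0 expr0n/= => /esym/eqP.
have nn i j : 0 <= Normc.normc (A i j) ^+ 2 by exact: sqr_ge0.
rewrite psumr_eq0 => [/allP h|i _]; last exact: sumr_ge0.
apply/matrixP => i j; rewrite mxE.
have := h i (mem_index_enum i); rewrite psumr_eq0//= => /allP /(_ j (mem_index_enum j)).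
by rewrite /= sqrf_eq0 => /eqP; exact: Normc.eq0_normc.
Qed.

Lemma cmx_CauchySchwarz A B : cmx_inner A B <= frobenius A * frobenius B.
Proof.
have [B0|Bn0] := eqVneq (frobenius B) 0.
  rewrite B0 mulr0 (frobenius_eq0 B0) cmx_innerC.
  by rewrite -[X in cmx_inner X](scale0r A) cmx_innerZl mul0r.
have b0 : 0 < frobenius B by rewrite lt_def Bn0 frobenius_ge0.
have [ab0|/ltW ab0] := leP (cmx_inner A B) 0.
  by apply: (le_trans ab0); rewrite mulr_ge0 ?frobenius_ge0.
set b := frobenius B ^+ 2; set t := cmx_inner A B.
have bE : cmx_inner B B = b by rewrite -frobenius_inner.
have : 0 <= cmx_inner (b *: A + (- t) *: B) (b *: A + (- t) *: B).
  by rewrite -frobenius_inner sqr_ge0.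
rewrite cmx_innerDl !cmx_innerZl 2!(cmx_innerC _ (_ + _)) !cmx_innerDl !cmx_innerZl.
rewrite bE (cmx_innerC B A) -/t -frobenius_inner => h.
rewrite -ler_sqr ?nnegrE ?mulr_ge0 ?frobenius_ge0// exprMn -/b.
have bp : 0 < b by rewrite exprn_gt0.
rewrite -subr_ge0 -(pmulr_rge0 _ bp); apply: le_trans h _.
rewrite le_eqVlt; apply/orP; left; apply/eqP.
rewrite ?mulNr [b * t]mulrC subrr mulr0 subr0.
by rewrite expr2 [b * _ ^+ 2]mulrC.
Qed.

Lemma frobeniusD A B : frobenius (A + B) <= frobenius A + frobenius B.
Proof.
rewrite -ler_sqr ?nnegrE ?addr_ge0 ?frobenius_ge0//.
rewrite frobenius_inner cmx_innerDl !(cmx_innerC _ (A + B)) !cmx_innerDl.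
rewrite sqrrD -!frobenius_inner (cmx_innerC B A) mulr2n !addrA lerD2r -!addrA.
by rewrite lerD2l lerD// cmx_CauchySchwarz.
Qed.

Lemma frobeniusZ k A : frobenius (k *: A) = `|k| * frobenius A.
Proof.
apply/eqP; rewrite -(eqrXn2 (n := 2)) ?mulr_ge0 ?frobenius_ge0//.
by rewrite exprMn real_normK ?num_real// !frobenius_inner cmx_innerZl
  cmx_innerC cmx_innerZl mulrA -expr2.
Qed.

HB.instance Definition _ := @Lmodule_isNormed.Build R (cmx R d)
  frobenius frobeniusD frobeniusZ frobenius_eq0.

End CmxNormed.

Section GradientFlow.
Variables (R : realType) (d : nat).
Implicit Types (f : cmx R d -> R^o) (A G H : cmx R d).

Definition is_gradient f A G : Prop :=
  differentiable f A /\ forall H, 'd f A H = cmx_inner G H.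

(* The gradient at A, and the junk value 0 if f is not differentiable at A. *)
Definition gradient f A : cmx R d := xget 0 (is_gradient f A).

Lemma gradient_eq f A G : is_gradient f A G -> gradient f A = G.
Proof.
move=> fG; apply: xget_subset1 => // G1 G2 [_ h1] [_ h2].
apply/eqP; rewrite -subr_eq0; apply/eqP/frobenius_eq0/eqP.
rewrite -sqrf_eq0 frobenius_inner cmx_innerDl -scaleN1r cmx_innerZl.
by rewrite -h1 -h2 mulN1r subrr.
Qed.

(* Only the values of F at times t >= 0 matter; the time derivative is taken
   within [0, +oo[, so it is the right derivative at t = 0. *)
Definition is_negative_gradient_flow f (F : cmx R d -> R -> cmx R d) : Prop :=
  forall A0, F A0 0 = A0 /\
    forall t : R, 0 <= t ->
      (s - t)^-1 *: (F A0 s - F A0 t) @[s --> within [set s | 0 <= s] t^']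
        --> - gradient f (F A0 t).

Definition energy A : R^o :=
  `|(A *m A^t*
     - A^t* *m A : cmx R d)| ^+ 2.

End GradientFlow.

(* Main.v *)
(**
Write M = [A, A^*], so that E(A) = |M|^2 and the gradient of E is 4 [M, A].
The key is the global Lojasiewicz inequality |M|^{3/2} <= C |[M, A]|. After a
unitary change of basis M = diag(h_1, ..., h_d), and with w_ij = |a_ij|^2,

  h_i = sum_j (w_ij - w_ji),    |[M, A]|^2 = sum_ij (h_i - h_j)^2 w_ij.

The h_i sum to zero, so by pigeonhole they have a gap of size at least
delta = (max h - min h) / d. Let S be the set of indices above the gap. The sum
of h over S is at least delta / 2, and it is the net flow of w out of S, so the
total weight of the pairs (i, j) in S x S^c is at least delta / 2. As
h_i - h_j >= delta on those pairs, |[M, A]|^2 >= delta^3 / 2.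

Along the flow f this makes |f(t) - f(s)| at most a constant times
E(f(s))^{1/4} - E(f(t))^{1/4}. The fourth root is not differentiable at 0, so
the argument is run with (E + b^4)^{1/4} and b -> 0.
*)

From HB Require Import structures.
Require Import Defs.
From mathcomp Require Import all_boot all_order all_algebra.
From mathcomp Require Import complex ring lra.
From mathcomp Require Import all_classical all_reals all_analysis.

Set Implicit Arguments.
Unset Strict Implicit.
Unset Printing Implicit Defensive.

Import Order.TTheory GRing.Theory Num.Theory.
Import numFieldNormedType.Exports.

Local Open Scope ring_scope.
Local Open Scope sesquilinear_scope.

(** * Gaps and cuts for net outflows of finite weights *)

(** Pigeonhole on the superlevel sets [S k] at the heights [h a - k * d], where [d] is the claimed
    width. They grow with [k], and as soon as [S k.+1 = S k] no value of [h] lies between the two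
    heights. *)
Lemma exists_gap (R : realFieldType) (T : finType) (h : T -> R) (a b : T) :
  h b < h a ->
  exists t, [/\ t <= h a, h b < t &
    forall i, t <= h i \/ h i <= t - (h a - h b) / #|T|%:R].
Proof.
move=> hba; set d := _ / _.
have T0 : (0 < #|T|)%N by apply/card_gt0P; exists a.
have T0R : 0 < #|T|%:R :> R by rewrite ltr0n.
have d0 : 0 < d by rewrite divr_gt0 ?subr_gt0.
have Td : h a - h b = #|T|%:R * d by rewrite mulrC divfK ?gt_eqF.
pose S (k : nat) : {set T} := [set i | h a - k%:R * d <= h i]%SET.
have Smono k : S k \subset S k.+1.
  apply/fintype.subsetP => i; rewrite !inE; apply: le_trans.
  by rewrite lerD2l lerN2 ler_wpM2r ?ler_nat// ltW.
have [k kT Sk] : exists2 k : nat, (k < #|T|)%N & S k.+1 = S k.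
  case: (pickP (fun k : 'I_#|T| => S k.+1 == S k)) => [k /eqP Sk|nS].
    by exists k.
  (* If each of the first [#|T|] inclusions were strict, [S #|T|] would have more than [#|T|]
     elements, since [a] is already in [S 0]. *)
  have cardS k : (k <= #|T|)%N -> (k < #|S k|)%N.
    elim: k => [_|k IH kT].
      by apply/card_gt0P; exists a; rewrite inE mul0r subr0.
    apply: leq_ltn_trans (IH (ltnW kT)) _; apply: proper_card.
    by rewrite finset.properEneq Smono andbT eq_sym (nS (Ordinal kT)).
  by have := cardS _ (leqnn _); rewrite ltnNge max_card.
exists (h a - k%:R * d); split.
- by rewrite lerBlDr lerDl mulr_ge0 ?ler0n// ltW.
- rewrite ltrBrDr -ltrBrDl Td ltr_pM2r// ltr_nat//.
- move=> i; have [|hi] := leP (h a - k%:R * d) (h i); [by left|right].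
  have : i \notin S k.+1 by rewrite Sk inE -ltNge.
  by rewrite inE -ltNge => /ltW; rewrite -natr1 mulrDl mul1r opprD addrA.
Qed.

Lemma dissipation_lower_bound (R : realFieldType) (T : finType)
    (w : T -> T -> R) (h : T -> R) :
  (forall i j, 0 <= w i j) -> (forall i, h i = \sum_j (w i j - w j i)) ->
  forall a b, (h a - h b) ^+ 3 <=
    2 * #|T|%:R ^+ 3 * \sum_i \sum_j (h i - h j) ^+ 2 * w i j.
Proof.
move=> w0 hE a b.
have D0 i : 0 <= \sum_j (h i - h j) ^+ 2 * w i j.
  by apply: sumr_ge0 => j _; rewrite mulr_ge0 ?sqr_ge0.
have [hab|hba] := leP (h a) (h b).
  apply: (@le_trans _ _ 0).
    by rewrite exprS mulr_le0_ge0 ?subr_le0 ?sqr_ge0.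
  by rewrite !mulr_ge0 ?exprn_ge0 ?ler0n ?sumr_ge0.
have [t [ta bt gap]] := exists_gap hba.
have T0R : 0 < #|T|%:R :> R by rewrite ltr0n; apply/card_gt0P; exists a.
move: gap; set d := _ / _ => gap.
have d0 : 0 < d by rewrite divr_gt0 ?subr_gt0.
have -> : h a - h b = #|T|%:R * d by rewrite mulrC divfK ?gt_eqF.
pose S : {set T} := [set i | t <= h i]%SET.
have aS : a \in S by rewrite inE.
have bS : b \notin S by rewrite inE -ltNge.
have sum0 : \sum_i h i = 0.
  under eq_bigr do rewrite hE sumrB.
  by rewrite sumrB [X in _ - X]exchange_big subrr.
have outS j : j \notin S -> h j <= t - d.
  by rewrite inE; case: (gap j) => // ->.
(* If [d / 2 <= t], the term of [a] suffices, the others over [S] being nonnegative. Otherwise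
   [t - d < - (d / 2)], so the complement, which contains [b], sums to at most [- (d / 2)], while
   the total is zero. *)
have hS : d / 2 <= \sum_(i in S) h i.
  have [td|td] := leP (d / 2) t.
    rewrite (bigD1 a)//= (le_trans (le_trans td ta))// lerDl sumr_ge0// => i.
    by rewrite inE => /andP[]; lra.
  have : \sum_(i | i \notin S) h i <= - (d / 2).
    rewrite (bigD1 b)//= -[leRHS]addr0 lerD//.
      by have := outS _ bS; lra.
    by apply: sumr_le0 => i /andP[/outS]; lra.
  by move: sum0; rewrite (bigID (mem S))/=; lra.
have cut : \sum_(i in S) h i <= \sum_(i in S) \sum_(j | j \notin S) w i j.
  (* Flow between two points of [S] cancels in the sum. *)
  have -> : \sum_(i in S) h i =
      \sum_(i in S) \sum_(j | j \notin S) (w i j - w j i).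
    under eq_bigr do rewrite hE (bigID (mem S))/=.
    rewrite big_split/= [X in X + _](_ : _ = 0) ?add0r//.
    under eq_bigr do rewrite sumrB.
    by rewrite sumrB [X in _ - X]exchange_big subrr.
  apply: ler_sum => i _; apply: ler_sum => j _.
  by rewrite lerBlDr lerDl.
have dis : d ^+ 2 * \sum_(i in S) \sum_(j | j \notin S) w i j <=
    \sum_i \sum_j (h i - h j) ^+ 2 * w i j.
  rewrite [leRHS](bigID (mem S))/= mulr_sumr -[leLHS]addr0 lerD ?sumr_ge0//.
  apply: ler_sum => i; rewrite inE => iS.
  rewrite [leRHS](bigID (mem S))/= mulr_sumr -[leLHS]add0r lerD//.
    by apply: sumr_ge0 => j _; rewrite mulr_ge0 ?sqr_ge0.
  apply: ler_sum => j /outS jS; rewrite ler_wpM2r// ler_sqr ?nnegrE; lra.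
(* [d ^+ 2] is the least squared difference across the cut and [d / 2] the least weight crossing it;
   their product fixes the constant. *)
have -> : (#|T|%:R * d) ^+ 3 = #|T|%:R ^+ 3 * 2 * (d ^+ 2 * (d / 2)).
  by field.
rewrite [2 * _]mulrC ler_wpM2l ?mulr_ge0 ?exprn_ge0 ?ler0n//.
apply: le_trans dis; rewrite ler_wpM2l ?sqr_ge0//; exact: le_trans cut.
Qed.

Local Open Scope classical_set_scope.

(** * Unitary conjugation *)

Section UnitaryConj.
Variables (C : numClosedFieldType) (n : nat).
Implicit Types P X Y : 'M[C]_n.

Lemma unitarymx_trmxCl P : P \is unitarymx -> P^t* *m P = 1%:M.
Proof. by move=> Pu; rewrite -invmx_unitary// mulVmx// unitarymx_unit. Qed.

Lemma trmxC_unitary_conj P X : (P *m X *m P^t*)^t* = P *m X^t* *m P^t*.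
Proof. by rewrite !trmx_mul !map_mxM trmxCK mulmxA. Qed.

Lemma unitary_conjM P X Y : P \is unitarymx ->
  (P *m X *m P^t*) *m (P *m Y *m P^t*) = P *m (X *m Y) *m P^t*.
Proof.
by move=> Pu; rewrite -!mulmxA [P^t* *m (P *m _)]mulmxA unitarymx_trmxCl// mul1mx.
Qed.

Lemma mxtrace_unitary_conj P X : P \is unitarymx ->
  \tr (P *m X *m P^t*) = \tr X.
Proof. by move=> Pu; rewrite mxtrace_mulC mulmxA unitarymx_trmxCl// mul1mx. Qed.

End UnitaryConj.

(** * The self-commutator and its Lojasiewicz inequality *)

Section SelfCommutator.
Variables (R : realType) (d : nat).
Implicit Types (A B X : cmx R d) (P : 'M[R[i]]_d).

Definition selfcomm A : cmx R d := (A *m A^t* - A^t* *m A : 'M[R[i]]_d).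

Definition commutator A B : cmx R d := (A *m B - B *m A : 'M[R[i]]_d).

Lemma frobenius_unitary_conj P A : P \is unitarymx ->
  frobenius (P *m A *m P^t* : cmx R d) = frobenius A.
Proof.
move=> Pu; apply/eqP; rewrite -(eqrXn2 (n := 2)) ?frobenius_ge0//.
rewrite !frobenius_inner /cmx_inner trmxC_unitary_conj unitary_conjM//.
by rewrite mxtrace_unitary_conj.
Qed.

Lemma selfcomm_unitary_conj P A : P \is unitarymx ->
  selfcomm (P *m A *m P^t*) = P *m selfcomm A *m P^t*.
Proof.
move=> Pu; rewrite /selfcomm trmxC_unitary_conj !unitary_conjM//.
by rewrite -mulmxBl -mulmxBr.
Qed.

Lemma commutator_unitary_conj P A B : P \is unitarymx ->
  commutator (P *m A *m P^t*) (P *m B *m P^t*) =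
  P *m commutator A B *m P^t*.
Proof.
move=> Pu; rewrite /commutator !unitary_conjM//.
by rewrite -mulmxBl -mulmxBr.
Qed.

Lemma selfcomm_hermitian A : (selfcomm A)^t* = selfcomm A.
Proof.
by rewrite /selfcomm linearB/= map_mxB !trmx_mul !map_mxM trmxCK.
Qed.

Definition entry_weight A i j : R := Normc.normc (A i j) ^+ 2.

Definition net_outflow A i : R := \sum_j (entry_weight A i j - entry_weight A j i).

Lemma normc_sqr (z : R[i]) :
  Normc.normc z ^+ 2 = complex.Re z ^+ 2 + complex.Im z ^+ 2.
Proof. by case: z => a b /=; rewrite sqr_sqrtr// addr_ge0 ?sqr_ge0. Qed.

Lemma selfcomm_diag A i : (selfcomm A : 'M[R[i]]_d) i i = (net_outflow A i)%:C%C.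
Proof.
rewrite !mxE -sumrB rmorph_sum; apply: eq_bigr => j _.
rewrite !mxE /entry_weight !normc_sqr; case: (A i j) => a b; case: (A j i) => a' b' /=.
by apply/eqP; rewrite eq_complex /=; apply/andP; split; apply/eqP; ring.
Qed.

Lemma entry_weight_ge0 A i j : 0 <= entry_weight A i j.
Proof. exact: sqr_ge0. Qed.

(** The exponents 6 and 4 are 3/2 and 1 cleared of fractions. With [m = h a - h b] the spread of the
    diagonal, the squared norm of [selfcomm A] is at most [d * m ^+ 2]; cubing this and squaring the
    bound on [m ^+ 3] gives [d ^+ 3 * (2 * d ^+ 3) ^+ 2 = 4 * d ^+ 9]. *)
Lemma commutator_lb_diag A (s : 'rV[R[i]]_d) : (0 < d)%N -> selfcomm A = diag_mx s ->
  frobenius (selfcomm A) ^+ 6 <=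
    4 * d%:R ^+ 9 * frobenius (commutator (selfcomm A) A) ^+ 4.
Proof.
move=> d0 As; pose h := net_outflow A.
have hs i : s 0 i = (h i)%:C%C by rewrite -selfcomm_diag As mxE eqxx mulr1n.
have nM : frobenius (selfcomm A) ^+ 2 = \sum_i h i ^+ 2.
  rewrite frobenius_sqr; apply: eq_bigr => i _.
  rewrite (bigD1 i)//= selfcomm_diag normc_sqr/= expr0n/= addr0 big1 ?addr0//.
  by move=> j ji; rewrite As mxE eq_sym (negPf ji) mulr0n normc_sqr/= expr0n/= addr0.
have nG : frobenius (commutator (selfcomm A) A) ^+ 2 =
    \sum_i \sum_j (h i - h j) ^+ 2 * entry_weight A i j.
  rewrite frobenius_sqr; apply: eq_bigr => i _; apply: eq_bigr => j _.
  rewrite /commutator As mul_diag_mx mul_mx_diag !mxE !hs /entry_weight !normc_sqr.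
  by case: (A i j) => a b /=; ring.
pose i0 := Ordinal d0.
have [a _ ha] := Order.TotalTheory.arg_maxP (i0 := i0) (P := xpredT) h isT.
have [b _ hb] := Order.TotalTheory.arg_minP (i0 := i0) (P := xpredT) h isT.
have h0 : \sum_i h i = 0.
  rewrite /h /net_outflow; under eq_bigr do rewrite sumrB.
  by rewrite sumrB [X in _ - X]exchange_big subrr.
have d0R : 0 < d%:R :> R by rewrite ltr0n.
have ha0 : 0 <= h a.
  have : \sum_i h i <= \sum_(i < d) h a by apply: ler_sum => i _; exact: ha.
  by rewrite h0 sumr_const card_ord -mulr_natl pmulr_rge0.
have hb0 : h b <= 0.
  have : \sum_(i < d) h b <= \sum_i h i by apply: ler_sum => i _; exact: hb.
  by rewrite h0 sumr_const card_ord -mulr_natl pmulr_rle0.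
(* Both [h i] and 0 lie in the interval from [h b] to [h a]. *)
have hm i : h i ^+ 2 <= (h a - h b) ^+ 2.
  by rewrite -subr_ge0; have := ha i isT; have := hb i isT; rewrite /=; nra.
have nMm : frobenius (selfcomm A) ^+ 2 <= d%:R * (h a - h b) ^+ 2.
  have : \sum_i h i ^+ 2 <= \sum_(i < d) (h a - h b) ^+ 2.
    by apply: ler_sum => i _; exact: hm.
  by rewrite nM sumr_const card_ord mulr_natl.
have key : (h a - h b) ^+ 3 <=
    2 * d%:R ^+ 3 * frobenius (commutator (selfcomm A) A) ^+ 2.
  rewrite nG -[X in X%:R ^+ 3]card_ord.
  exact: dissipation_lower_bound (entry_weight_ge0 A) (fun=> erefl) a b.
have -> : frobenius (selfcomm A) ^+ 6 = (frobenius (selfcomm A) ^+ 2) ^+ 3.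
  by rewrite -exprM.
apply: (@le_trans _ _ ((d%:R * (h a - h b) ^+ 2) ^+ 3)).
  by rewrite ler_pXn2r ?nnegrE ?sqr_ge0// mulr_ge0 ?sqr_ge0// ltW.
have -> : (d%:R * (h a - h b) ^+ 2) ^+ 3 = d%:R ^+ 3 * ((h a - h b) ^+ 3) ^+ 2.
  by rewrite exprMn -!exprM.
have -> : 4 * d%:R ^+ 9 * frobenius (commutator (selfcomm A) A) ^+ 4 =
  d%:R ^+ 3 *
   (2 * d%:R ^+ 3 * frobenius (commutator (selfcomm A) A) ^+ 2) ^+ 2 by ring.
rewrite ler_wpM2l ?exprn_ge0 ?ler0n// ler_pXn2r// nnegrE.
- by rewrite exprn_ge0// subr_ge0 (le_trans hb0).
- by rewrite mulr_ge0 ?sqr_ge0// mulr_ge0// exprn_ge0// ler0n.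
Qed.

(** The self-commutator is Hermitian, so the spectral theorem diagonalizes it by a unitary matrix,
    and both norms are invariant under unitary conjugation. *)
Lemma commutator_lb A : (0 < d)%N ->
  frobenius (selfcomm A) ^+ 6 <=
    4 * d%:R ^+ 9 * frobenius (commutator (selfcomm A) A) ^+ 4.
Proof.
move=> d0; set M := selfcomm A.
have Mn : (M : 'M[R[i]]_d) \is normalmx by apply/normalmxP; rewrite selfcomm_hermitian.
have /orthomx_spectralP := Mn; set P := spectralmx _; set s := spectral_diag _.
have Pu : P \is unitarymx := spectral_unitarymx _.
rewrite invmx_unitary// => Ms.
pose B : cmx R d := P *m A *m P^t*.
have MB : selfcomm B = P *m M *m P^t* by rewrite selfcomm_unitary_conj.
have Bs : selfcomm B = diag_mx s.
  rewrite MB Ms; have PP : P *m P^t* = 1%:M by apply/unitarymxP.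
  by rewrite !mulmxA PP mul1mx -mulmxA PP mulmx1.
have nM : frobenius (selfcomm B) = frobenius M.
  by rewrite MB; exact: frobenius_unitary_conj.
have nC : frobenius (commutator (selfcomm B) B) = frobenius (commutator M A).
  rewrite MB -(frobenius_unitary_conj (commutator M A) Pu).
  by congr frobenius; exact: commutator_unitary_conj.
(* Rewriting with [nM] and [nC] would make unification unfold [selfcomm]. *)
have transport (k x y x' y' : R) : x = x' -> y = y' ->
    x ^+ 6 <= k * y ^+ 4 -> x' ^+ 6 <= k * y' ^+ 4 by move=> -> ->.
exact: transport nM nC (commutator_lb_diag d0 Bs).
Qed.

End SelfCommutator.

(** * Trace identities *)

Section MxTrace.
Variables (C : numClosedFieldType) (n : nat).
Implicit Types X Y M : 'M[C]_n.

Lemma mxtrace_trmxC X : \tr (X^t*) = (\tr X)^*.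
Proof. by rewrite trace_map_mx mxtrace_tr. Qed.

Lemma mxtrace_commutatorM M X Y :
  \tr ((X *m Y - Y *m X) *m M) = \tr (Y *m (M *m X - X *m M)).
Proof.
rewrite mulmxBl mulmxBr !raddfB/= !mulmxA; congr (_ - _).
by rewrite -[X *m Y *m M]mulmxA mxtrace_mulC.
Qed.

End MxTrace.

(** * The gradient of the energy *)

Section EnergyGradient.
Variables (R : realType) (d : nat).
Implicit Types (A B X Y : cmx R d).

Lemma normr_frobenius A : `|A| = frobenius A.
Proof. by []. Qed.

Lemma cmx_innerDr A B X : cmx_inner A (B + X) = cmx_inner A B + cmx_inner A X.
Proof. by rewrite cmx_innerC cmx_innerDl !(cmx_innerC A). Qed.

Lemma frobenius_sqrD A B :
  `|A + B| ^+ 2 = `|A| ^+ 2 + 2 * cmx_inner A B + `|B| ^+ 2.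
Proof.
rewrite !normr_frobenius !frobenius_inner cmx_innerDl !cmx_innerDr (cmx_innerC B A).
by ring.
Qed.

Lemma cmx_innerZr (k : R) A B : cmx_inner A (k *: B) = k * cmx_inner A B.
Proof. by rewrite cmx_innerC cmx_innerZl cmx_innerC. Qed.

Lemma normr_cmx_inner A B : `|cmx_inner A B| <= `|A| * `|B|.
Proof.
rewrite ler_norml cmx_CauchySchwarz andbT lerNl -mulN1r -cmx_innerZl scaleN1r.
by rewrite -(normrN A) cmx_CauchySchwarz.
Qed.

Lemma normc_ge0 (z : R[i]) : 0 <= Normc.normc z.
Proof. by case: z => a b; exact: sqrtr_ge0. Qed.

Lemma normc_le_norm A i j : Normc.normc (A i j) <= `|A|.
Proof.
rewrite -ler_sqr ?nnegrE ?normc_ge0 ?normr_ge0//.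
rewrite normr_frobenius frobenius_sqr (bigD1 i)//= (bigD1 j)//= -addrA lerDl.
by rewrite addr_ge0//; do 2?[apply: sumr_ge0 => ? _]; rewrite ?sqr_ge0//;
  apply: sumr_ge0 => ? _; exact: sqr_ge0.
Qed.

(** A crude constant is enough for the Taylor remainder: each entry is at most [d] times the product
    of the norms, and there are [d ^+ 2] entries. *)
Lemma norm_mulmx A B : `|(A *m B : cmx R d)| <= d%:R ^+ 2 * (`|A| * `|B|).
Proof.
have entry i j : Normc.normc ((A *m B : 'M[R[i]]_d) i j) <= d%:R * (`|A| * `|B|).
  rewrite mxE; apply: (@le_trans _ _ (\sum_(k < d) `|A| * `|B|)); last first.
    by rewrite sumr_const card_ord mulr_natl.
  elim/big_ind2 : _ => [|x a y b xa yb|k _].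
  - by rewrite Normc.normc0.
  - by rewrite (le_trans (le_normcD _ _))// lerD.
  - by rewrite Normc.normcM ler_pM ?normc_ge0 ?normc_le_norm.
rewrite -ler_sqr ?nnegrE ?mulr_ge0 ?exprn_ge0//.
rewrite normr_frobenius frobenius_sqr.
apply: (@le_trans _ _ (\sum_(i < d) \sum_(j < d) (d%:R * (`|A| * `|B|)) ^+ 2)).
  apply: ler_sum => i _; apply: ler_sum => j _.
  by rewrite ler_sqr ?nnegrE ?normc_ge0 ?mulr_ge0.
rewrite !sumr_const !card_ord -mulrnA -[leLHS]mulr_natl natrM le_eqVlt; apply/orP; left; apply/eqP.
by ring.
Qed.

Lemma norm_trmxC A : `|(A^t* : cmx R d)| = `|A|.
Proof.
apply/eqP; rewrite -(eqrXn2 (n := 2)) ?normr_ge0// !normr_frobenius !frobenius_sqr.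
rewrite exchange_big/=; apply/eqP/eq_bigr => i _; apply: eq_bigr => j _.
by rewrite !mxE !normc_sqr; case: (A i j) => a b /=; rewrite sqrrN.
Qed.

(** The real-bilinear form that polarizes the quadratic map [selfcomm]: its value at [X], [X] is
    [selfcomm X] by conversion. *)
Definition selfcomm_form X Y : cmx R d := (X *m Y^t* - Y^t* *m X : 'M[R[i]]_d).

Lemma norm_selfcomm_form X Y :
  `|selfcomm_form X Y| <= 2 * d%:R ^+ 2 * (`|X| * `|Y|).
Proof.
have := ler_normB (X *m Y^t* : cmx R d) (Y^t* *m X : cmx R d).
move/le_trans; apply.
have := norm_mulmx X (Y^t*); have := norm_mulmx (Y^t*) X.
by rewrite !norm_trmxC; lra.
Qed.

Lemma selfcommD A X : selfcomm (A + X) = selfcomm A +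
  (selfcomm_form A X + selfcomm_form X A) + selfcomm X.
Proof.
pose a : 'M[R[i]]_d := A; pose x : 'M[R[i]]_d := X.
have adjD : (a + x)^t* = a^t* + x^t* by rewrite linearD/= map_mxD.
rewrite /selfcomm /selfcomm_form -[A]/a -[X]/x.
rewrite -[(a + x : cmx R d)]/(a + x : 'M[R[i]]_d).
rewrite adjD !(mulmxDl, mulmxDr).
(* The products are abstracted so that [mxE] does not expand them into sums. *)
move: (a *m a^t*) (a *m x^t*) (x *m a^t*) (x *m x^t*) => b1 b2 b3 b4.
move: (a^t* *m a) (a^t* *m x) (x^t* *m a) (x^t* *m x) => c1 c2 c3 c4.
by apply/matrixP => i j; rewrite !mxE; ring.
Qed.

(** The two traces are complex conjugates when [M] is Hermitian, so their real parts agree. *)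
Lemma cmx_inner_trmxC (M Y : 'M[R[i]]_d) : M^t* = M ->
  cmx_inner M (Y^t*) = cmx_inner M Y.
Proof.
move=> Mh; rewrite /cmx_inner trmxCK -[in LHS]Mh mxtrace_mulC -[Y in LHS]trmxCK.
rewrite -map_mxM -trmx_mul mxtrace_trmxC.
by case: (\tr (Y^t* *m M)).
Qed.

Lemma selfcomm_form_trmxC X Y : (selfcomm_form X Y)^t* = selfcomm_form Y X.
Proof.
by rewrite /selfcomm_form linearB/= map_mxB !trmx_mul !map_mxM !trmxCK.
Qed.

(** The two forms are adjoint to each other, so they pair equally with the Hermitian [selfcomm A];
    cyclicity of the trace then isolates [X]. *)
Lemma cmx_inner_selfcomm A X :
  cmx_inner (selfcomm A) (selfcomm_form A X + selfcomm_form X A) =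
  2 * cmx_inner (commutator (selfcomm A) A) X.
Proof.
have e : cmx_inner (selfcomm A) (selfcomm_form X A) =
    cmx_inner (commutator (selfcomm A) A) X.
  rewrite /cmx_inner selfcomm_form_trmxC; congr complex.Re.
  exact: mxtrace_commutatorM.
rewrite cmx_innerDr.
rewrite -[selfcomm_form A X]selfcomm_form_trmxC.
by rewrite (cmx_inner_trmxC _ (selfcomm_hermitian A)) e mulr_natl.
Qed.

(** One factor 2 comes from differentiating the square, the other from [cmx_inner_selfcomm]. *)
Definition energy_grad A : cmx R d := 4 *: commutator (selfcomm A) A.

Lemma energyE A : energy A = `|selfcomm A| ^+ 2.
Proof. by []. Qed.

(** The expansion is exact: with [L] and [Q] the linear and quadratic parts of the increment of
    [selfcomm], only [2 * cmx_inner M Q] and the squared norm of [L + Q] remain. For [X] in the unit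
    ball, [L + Q] is bounded linearly in [X]. *)
Lemma energy_grad_remainder A : exists C : R, forall X, `|X| <= 1 ->
  `|energy (X + A) - energy A - cmx_inner (energy_grad A) X| <= C * `|X| ^+ 2.
Proof.
have [k k0 formk] : exists2 k : R, 0 <= k & forall X Y,
    `|selfcomm_form X Y| <= k * (`|X| * `|Y|).
  exists (2 * d%:R ^+ 2); first by rewrite mulr_ge0 ?exprn_ge0.
  exact: norm_selfcomm_form.
pose M := selfcomm A.
exists (2 * `|M| * k + (2 * k * `|A| + k) ^+ 2) => X X1.
set L := selfcomm_form A X + selfcomm_form X A; pose Q := selfcomm X.
have ML : cmx_inner M L = 2 * cmx_inner (commutator M A) X.
  exact: cmx_inner_selfcomm.
have -> : energy (X + A) - energy A - cmx_inner (energy_grad A) X =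
    2 * cmx_inner M Q + `|L + Q| ^+ 2.
  have -> : energy (X + A) = `|M + (L + Q)| ^+ 2.
    by rewrite energyE [X + A]addrC selfcommD -addrA.
  by rewrite energyE frobenius_sqrD (cmx_innerDr M L Q) ML cmx_innerZl -/M; ring.
have x0 : 0 <= `|X| by []; have a0 : 0 <= `|A| by []; have m0 : 0 <= `|M| by [].
have Qx : `|Q| <= k * `|X| ^+ 2 by exact: formk.
have Lx : `|L| <= 2 * k * `|A| * `|X|.
  have := ler_normD (selfcomm_form A X) (selfcomm_form X A).
  move/le_trans; apply.
  apply: (le_trans (lerD (formk A X) (formk X A))).
  by rewrite le_eqVlt; apply/orP; left; apply/eqP; ring.
have LQx : `|L + Q| <= (2 * k * `|A| + k) * `|X|.
  apply: (le_trans (ler_normD _ _)); rewrite mulrDl lerD// (le_trans Qx)//.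
  by rewrite ler_wpM2l// expr2 ler_piMl.
rewrite (le_trans (ler_normD _ _))// [leRHS]mulrDl lerD//.
  rewrite normrM ger0_norm// -!mulrA ler_wpM2l// (le_trans (normr_cmx_inner _ _))//.
  by rewrite ler_wpM2l.
by rewrite ger0_norm ?sqr_ge0// -exprMn ler_sqr ?nnegrE// mulr_ge0// addr_ge0// !mulr_ge0.
Qed.

Lemma cmx_inner_is_linear A : linear (cmx_inner A : cmx R d -> R^o).
Proof. by move=> k X Y; rewrite cmx_innerDr cmx_innerZr. Qed.

HB.instance Definition _ A :=
  GRing.isLinear.Build R (cmx R d) R^o *:%R (cmx_inner A) (@cmx_inner_is_linear A).

Lemma cmx_inner_continuous A : continuous (cmx_inner A : cmx R d -> R^o).
Proof.
apply/linear_bounded_continuous/linear_boundedP; near=> r => X.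
by rewrite (le_trans (normr_cmx_inner _ _))// ler_wpM2r.
Unshelve. all: by end_near. Qed.

Lemma is_gradient_energy A : is_gradient (@energy R d) A (energy_grad A).
Proof.
have o : (@energy R d) \o shift A =
    cst (energy A) + (cmx_inner (energy_grad A) : cmx R d -> R^o) +o_ 0 id.
  have [C HC] := energy_grad_remainder A.
  have C0 : 0 < `|C| + 1 by rewrite ltr_wpDl.
  apply/eqaddoP => _/posnumP[e]; near=> X.
  rewrite !fctE /= opprD addrA (le_trans (HC X _))//.
  apply: (@le_trans _ _ ((`|C| + 1) * `|X| ^+ 2)).
    by rewrite ler_wpM2r// (le_trans (ler_norm _))// lerDl.
  by rewrite expr2 mulrA ler_wpM2r// mulrC -ler_pdivlMr.
(* The expansion first identifies ['d]; [diff_locallyP] then turns the same expansion into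
   differentiability. *)
have dE : 'd (@energy R d) A = cmx_inner (energy_grad A) :> (_ -> _).
  by apply: diff_unique o; exact: cmx_inner_continuous.
split; last by move=> H; rewrite dE.
by apply/diff_locallyP; rewrite dE; split => //; exact: cmx_inner_continuous.
Unshelve. all: by end_near. Qed.

Lemma energy_continuous : continuous (@energy R d).
Proof. by move=> A; apply: differentiable_continuous; case: (is_gradient_energy A). Qed.

End EnergyGradient.

(** * Fourth roots and the perturbed Lojasiewicz inequality *)

Section FourthRoot.
Variable R : realType.
Implicit Types a b q g c x : R.

Lemma powR_fourthK x : 0 <= x -> (x `^ 4^-1) ^+ 4 = x.
Proof.
by move=> x0; rewrite -powR_mulrn ?powR_ge0// -powRrM mulVf// powRr1.
Qed.

Lemma ler_powR_fourth x y : 0 <= x <= y -> x `^ 4^-1 <= y `^ 4^-1 :> R.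
Proof.
by move=> /andP[x0 xy]; rewrite ge0_ler_powR ?nnegrE// (le_trans x0).
Qed.

(** The cross terms of the binomial expansion are nonnegative. This bounds by [b] the cost of
    smoothing the fourth root. *)
Lemma powR_fourth_addX4 x b : 0 <= x -> 0 <= b ->
  (x + b ^+ 4) `^ 4^-1 <= x `^ 4^-1 + b.
Proof.
move=> x0 b0; have r0 : 0 <= x `^ 4^-1 by exact: powR_ge0.
rewrite -(@ler_pXn2r _ 4) ?nnegrE ?powR_ge0 ?addr_ge0//.
rewrite powR_fourthK ?addr_ge0 ?exprn_ge0// -[x in leLHS]powR_fourthK//.
set r := _ `^ _ in r0 *.
have -> : (r + b) ^+ 4 = r ^+ 4 + b ^+ 4 +
  (4 * (r ^+ 3 * b) + 6 * (r ^+ 2 * b ^+ 2) + 4 * (r * b ^+ 3)) by ring.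
by rewrite lerDl !addr_ge0 ?mulr_ge0 ?exprn_ge0.
Qed.

Lemma is_derive_powR_fourth (x : R) : 0 < x ->
  is_derive x 1 (fun y => y `^ 4^-1) (4^-1 * (x `^ 4^-1) ^- 3).
Proof.
move=> x0; rewrite -powR_invn ?powR_ge0// -powRrM.
have -> : 4^-1 * - 3%:R = 4^-1 - 1 :> R by field.
exact: is_derive1_powR.
Qed.

(* When the perturbation [b] exceeds [a] the Lojasiewicz bound at [q] is
   unavailable, but then [q] itself is of order [b]. *)
Lemma lojasiewicz_perturbed a b q g c : 1 <= c -> 0 <= a -> 0 < b -> 0 <= g ->
  0 < q -> q ^+ 4 = a ^+ 4 + b ^+ 4 -> a ^+ 3 <= c * g ->
  g <= 8 * c * (g ^+ 2 * q ^- 3) + b ^+ 3.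
Proof.
move=> c1 a0 b0 g0 q0 qab ag; have c0 : 0 < c by lra.
have q3 : 0 < q ^+ 3 by rewrite exprn_gt0.
(* If [q ^+ 3 <= 8 * c * g], the first term on the right already dominates [g]. Otherwise [b < a]
   would give [q <= 2 * a] and hence [q ^+ 3 <= 8 * c * g]; so [a <= b], [q <= 2 * b], and [b ^+ 3]
   dominates [g]. *)
have [qg|gq] := leP (q ^+ 3) (8 * c * g).
  rewrite -[leLHS]addr0 lerD ?exprn_ge0 ?(ltW b0)//.
  have -> : 8 * c * (g ^+ 2 * q ^- 3) = g * (8 * c * g) / q ^+ 3.
    by field; rewrite gt_eqF.
  by rewrite ler_pdivlMr// ler_wpM2l.
have r0 : 0 <= 8 * c * (g ^+ 2 * q ^- 3).
  by rewrite !mulr_ge0 ?sqr_ge0 ?invr_ge0 ?(ltW c0) ?(ltW q3).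
rewrite -[leLHS]add0r lerD//.
have le4 (u v : R) : 0 <= u -> 0 <= v -> u ^+ 4 <= v ^+ 4 -> u <= v.
  by move=> u0 v0; rewrite ler_pXn2r ?nnegrE.
have ab : a <= b.
  rewrite leNgt; apply/negP => ba.
  have : q <= 2 * a.
    apply: le4; rewrite ?mulr_ge0 ?(ltW q0)// qab exprMn.
    have : b ^+ 4 <= a ^+ 4 by rewrite ler_pXn2r ?nnegrE ?(ltW b0) ?(ltW ba).
    have : 0 <= a ^+ 4 by rewrite exprn_ge0.
    by lra.
  move=> qa; have : q ^+ 3 <= (2 * a) ^+ 3.
    by rewrite ler_pXn2r ?nnegrE ?mulr_ge0 ?(ltW q0).
  by rewrite exprMn; lra.
have qb : q <= 2 * b.
  apply: le4; rewrite ?mulr_ge0 ?(ltW q0) ?(ltW b0)// qab exprMn.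
  have : a ^+ 4 <= b ^+ 4 by rewrite ler_pXn2r ?nnegrE ?(ltW b0).
  have : 0 <= b ^+ 4 by rewrite exprn_ge0// ltW.
  by lra.
have : q ^+ 3 <= (2 * b) ^+ 3.
  by rewrite ler_pXn2r ?nnegrE ?mulr_ge0 ?(ltW q0) ?(ltW b0).
rewrite exprMn.
have : g <= c * g by rewrite ler_peMl.
by lra.
Qed.

End FourthRoot.

(** The arithmetic that removes the smoothing in [curve_length]: [p], [q] are the smoothed fourth
    roots at times [t], [s], while [u], [v] are the exact ones, and [w] is the cube of [b]. *)
Lemma ler_of_perturbed (R : realFieldType) (x y p q u v w K b e s t : R) :
  x + K * p - w * t <= y + K * q - w * s -> K * q <= K * (v + b) -> K * u <= K * p ->
  b * (K + (t - s)) <= e -> w * (t - s) <= b * (t - s) ->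
  x + - 1 * y <= K * (v - u) + e.
Proof. by lra. Qed.

(** The fourth power of this inequality follows from [commutator_lb]. As the constant is at least 1,
    it may be replaced there by its fourth power, which avoids a root of it. *)
Lemma energy_lojasiewicz (R : realType) (d : nat) (A : cmx R d) : (0 < d)%N ->
  (energy A `^ 4^-1) ^+ 3 <= 4 * d%:R ^+ 9 * `|energy_grad A|.
Proof.
move=> d0; set c := 4 * _; set g := `|energy_grad A|.
have d1 : 1 <= d%:R ^+ 9 :> R by rewrite exprn_ege1// ler1n.
have c1 : 1 <= c by rewrite /c; lra.
have c0 : 0 <= c by exact: le_trans c1.
have g0 : 0 <= g by exact: normr_ge0.
have c4 : c <= c ^+ 4 by rewrite (exprS c) ler_peMr// exprn_ege1.
rewrite -(@ler_pXn2r _ 4) ?nnegrE ?exprn_ge0 ?powR_ge0 ?mulr_ge0//.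
rewrite exprAC powR_fourthK ?sqr_ge0// energyE -exprM.
have := commutator_lb A d0; rewrite -!normr_frobenius => /le_trans; apply.
rewrite exprMn ler_pM ?exprn_ge0//.
rewrite ler_pXn2r ?nnegrE// /g normrZ ger0_norm// ler_peMl//; lra.
Qed.

(** * Length estimates along a gradient curve *)

Section Curve.
Variables (R : realType) (d : nat) (f : R -> cmx R d).
Hypothesis hf : forall t : R, 0 <= t ->
  (s - t)^-1 *: (f s - f t) @[s --> within [set s | 0 <= s] t^']
    --> - energy_grad (f t).

Lemma is_derive_curve (t : R) : 0 < t -> is_derive t 1 f (- energy_grad (f t)).
Proof.
move=> t0.
suff L : h^-1 *: ((f \o shift t) (h *: (1 : R)) - f t) @[h --> 0^'] -->
    - energy_grad (f t).
  by apply: DeriveDef; [exact: cvgP L|exact: cvg_lim L].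
(* Increments smaller than [t] keep [h + t] in the half-line, so the one-sided limit yields a
   two-sided derivative. *)
have sh : (h + t) @[h --> 0^'] --> within [set s | 0 <= s] t^'.
  move=> A; rewrite /within/= /dnbhs /within/= !nbhs_simpl/=.
  move=> /nbhs_ballP[e /= e0 eA]; apply/nbhs_ballP.
  exists (Num.min e t); first by rewrite /= lt_min e0.
  move=> h; rewrite /ball/= sub0r normrN lt_min => /andP[he ht] h0; apply: eA.
  - by rewrite /ball/= opprD addrCA subrr addr0 normrN.
  - by rewrite -subr_eq0 addrK.
  - by rewrite /=; move: ht; rewrite ltr_norml => /andP[]; lra.
have := cvg_comp _ _ sh (hf (ltW t0)); apply: cvg_trans.
apply: near_eq_cvg; near=> h.
by rewrite /= /GRing.scale/= mulr1 addrK.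
Unshelve. all: by end_near. Qed.

Lemma continuous_curve (t : R) : 0 < t -> {for t, continuous f}.
Proof.
move=> t0; apply: differentiable_continuous; apply/derivable1_diffP.
by case: (is_derive_curve t0).
Qed.

(** Near 0, [f s] is [f 0] plus [s] times a convergent difference quotient. *)
Lemma cvg_curve_at0 : f s @[s --> 0^'+] --> f 0.
Proof.
have q : (s - 0)^-1 *: (f s - f 0) @[s --> 0^'+] --> - energy_grad (f 0).
  apply: cvg_trans (hf (lexx 0)); apply: cvg_fmap2.
  move=> A; rewrite /at_right /within/= /dnbhs /within/=.
  move=> /nbhs_ballP[e /= e0 eA]; apply/nbhs_ballP; exists e => //= s es s0.
  by apply: eA => //; [rewrite gt_eqF|exact: ltW].
have id0 : s @[s --> (0:R)^'+] --> (0 : R) by apply: cvg_at_right_filter; exact: cvg_id.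
have L : (s *: ((s - 0)^-1 *: (f s - f 0)) + f 0) @[s --> 0^'+] --> f 0.
  rewrite -[X in _ --> X]add0r -(scale0r (- energy_grad (f 0))).
  exact: cvgD (cvgZ id0 q) (cvg_cst (f 0)).
apply: cvg_trans L; apply: near_eq_cvg; near=> s.
have s0 : s != 0 by rewrite gt_eqF.
by rewrite subr0 scalerA divff// scale1r subrK.
Unshelve. all: by end_near. Qed.

Lemma within_continuous_curve (a b : R) (V : normedModType R) (g : cmx R d -> V) :
  0 <= a -> a < b -> continuous g -> {within `[a, b], continuous (g \o f)}.
Proof.
move=> a0 ab gc.
have gfc t : 0 < t -> {for t, continuous (g \o f)}.
  by move=> t0; apply: continuous_comp; [exact: continuous_curve|exact: gc].
apply/continuous_within_itvP => //; split.
- by move=> x; rewrite in_itv/= => /andP[ax _]; apply: gfc; exact: le_lt_trans ax.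
- move: a0; rewrite le_eqVlt => /predU1P[<-|a0].
    by apply: continuous_cvg; [exact: gc|exact: cvg_curve_at0].
  by apply: cvg_at_right_filter; exact: gfc.
- by apply: cvg_at_left_filter; apply: gfc; exact: le_lt_trans ab.
Qed.

Lemma is_derive_comp_curve (t : R) (g : cmx R d -> R^o) : 0 < t ->
  differentiable g (f t) ->
  is_derive t 1 (g \o f : R -> R) ('d g (f t) (- energy_grad (f t))).
Proof.
move=> t0 gd; have [fd fE] := is_derive_curve t0.
have fd' : differentiable f t by apply/derivable1_diffP.
have gfd : differentiable (g \o f) t by apply: differentiable_comp.
apply: DeriveDef; first by apply/derivable1_diffP.
by rewrite deriveE// diff_comp//= -fE deriveE.
Qed.

Lemma is_derive_energy_curve (t : R) : 0 < t ->
  is_derive t 1 (fun u => energy (f u)) (- `|energy_grad (f t)| ^+ 2).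
Proof.
move=> t0; have [dE dEE] := is_gradient_energy (f t).
have := is_derive_comp_curve t0 dE; rewrite dEE -scaleN1r cmx_innerZr mulN1r.
by rewrite normr_frobenius frobenius_inner.
Qed.

Lemma is_derive_inner_curve (v : cmx R d) (t : R) : 0 < t ->
  is_derive t 1 (fun u => cmx_inner v (f u)) (- cmx_inner v (energy_grad (f t))).
Proof.
move=> t0.
have dv : differentiable (cmx_inner v : cmx R d -> R^o) (f t).
  by apply: linear_differentiable; exact: cmx_inner_continuous.
have := is_derive_comp_curve t0 dv; rewrite diff_lin; last exact: cmx_inner_continuous.
by rewrite linearN.
Qed.

Variables (c : R).
Hypothesis c1 : 1 <= c.
Hypothesis loj : forall A : cmx R d, (energy A `^ 4^-1) ^+ 3 <= c * `|energy_grad A|.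

(** Pairing with a fixed [v] makes the curve scalar, so monotonicity follows from the sign of a
    derivative. The factor 32 is the 8 of [lojasiewicz_perturbed] times the 4 that cancels the
    [4^-1] from differentiating the fourth root; the term in [b ^+ 3] absorbs the additive error. *)
Lemma curve_length_perturbed (v : cmx R d) (b s t : R) : `|v| <= 1 -> 0 < b ->
  0 <= s -> s < t ->
  cmx_inner v (f t) + 32 * c * (energy (f t) + b ^+ 4) `^ 4^-1 - b ^+ 3 * t <=
  cmx_inner v (f s) + 32 * c * (energy (f s) + b ^+ 4) `^ 4^-1 - b ^+ 3 * s.
Proof.
move=> v1 b0 s0 st.
have c0 : 0 < c by exact: lt_le_trans c1.
have b4 : 0 < b ^+ 4 by rewrite exprn_gt0.
have E0 (A : cmx R d) : 0 < energy A + b ^+ 4 by rewrite ltr_wpDl// sqr_ge0.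
pose q (A : cmx R d) := (energy A + b ^+ 4) `^ 4^-1.
pose g (u : R) : R := cmx_inner v (f u) + 32 * c * q (f u) - b ^+ 3 * u.
pose G (u : R) := energy_grad (f u).
have q0 A : 0 < q A by rewrite powR_gt0.
have dq (u : R) : 0 < u ->
    is_derive u 1 (fun u => q (f u)) (4^-1 * q (f u) ^- 3 * - `|G u| ^+ 2).
  move=> u0; have dE := is_derive_energy_curve u0.
  have dEb : is_derive u 1 (fun u => energy (f u) + b ^+ 4) (- `|G u| ^+ 2).
    by rewrite -[X in is_derive _ _ _ X]addr0; apply: is_deriveD.
  exact: (@is_derive1_comp R (fun y => y `^ 4^-1)
    (fun u => energy (f u) + b ^+ 4) u _ _ (is_derive_powR_fourth (E0 (f u))) dEb).
have dg (u : R) : 0 < u -> is_derive u 1 g (- cmx_inner v (G u) +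
    32 * c * (4^-1 * q (f u) ^- 3 * - `|G u| ^+ 2) - b ^+ 3 * 1).
  move=> u0; have dv := is_derive_inner_curve v u0; have dqu := dq _ u0.
  exact: is_deriveB.
have dgle0 (u : R) : 0 < u -> - cmx_inner v (G u) +
    32 * c * (4^-1 * q (f u) ^- 3 * - `|G u| ^+ 2) - b ^+ 3 * 1 <= 0.
  move=> u0.
  have key : `|G u| <= 8 * c * (`|G u| ^+ 2 * q (f u) ^- 3) + b ^+ 3.
    apply: (@lojasiewicz_perturbed _ (energy (f u) `^ 4^-1)) => //.
    - exact: powR_ge0.
    - by rewrite !powR_fourthK ?sqr_ge0// ltW.
  have : - cmx_inner v (G u) <= `|G u|.
    apply: (le_trans (ler_norm _)); rewrite normrN.
    by rewrite (le_trans (normr_cmx_inner _ _))// ler_piMl.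
  rewrite mulr1.
  have -> : 32 * c * (4^-1 * q (f u) ^- 3 * - `|G u| ^+ 2) =
    - (8 * c * (`|G u| ^+ 2 * q (f u) ^- 3)).
    have -> : 32 = 8 * 4 :> R by ring.
    by field; rewrite gt_eqF.
  by lra.
have gc : {within `[s, t], continuous g}.
  have cont : continuous (fun A => cmx_inner v A + 32 * c * q A : R).
    move=> A.
    have cE : (energy X + b ^+ 4) @[X --> A] --> energy A + b ^+ 4.
      exact: (cvgD (@energy_continuous R d A) (cvg_cst _)).
    have cr : {for energy A + b ^+ 4, continuous (fun y : R => y `^ 4^-1)}.
      apply: differentiable_continuous; apply/derivable1_diffP.
      by have [] := is_derive_powR_fourth (E0 A).
    have cq : q X @[X --> A] --> q A by exact: (cvg_comp _ _ cE cr).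
    have cv : cmx_inner v X @[X --> A] --> cmx_inner v A.
      exact: (@cmx_inner_continuous R d v A).
    exact: (cvgD cv (cvgM (cvg_cst (32 * c)) cq)).
  move=> x; apply: cvgB.
    exact: (within_continuous_curve s0 st cont).
  apply: continuous_subspaceT => y; apply: cvgM; [exact: cvg_cst|exact: cvg_id].
have pos u : u \in `]s, t[%R -> 0 < u.
  by rewrite in_itv/= => /andP[su _]; exact: le_lt_trans su.
apply: (@ler0_derive1_le_cc _ g s t) => //; rewrite ?in_itv/= ?lexx ?(ltW st)//.
- by move=> u /pos u0; case: (dg u u0).
- by move=> u /pos u0; rewrite derive1E; case: (dg u u0) => _ ->; exact: dgle0.
Qed.

Lemma curve_length (s t : R) : 0 <= s -> s <= t ->
  `|f t - f s| <= 32 * c * (energy (f s) `^ 4^-1 - energy (f t) `^ 4^-1).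
Proof.
move=> s0; rewrite le_eqVlt => /predU1P[->|st].
  by rewrite !subrr normr0 mulr0.
have c0 : 0 < c by exact: lt_le_trans c1.
have K0 : 0 < 32 * c + (t - s) by rewrite addr_gt0 ?mulr_gt0 ?subr_gt0.
(* The unit vector along [D] recovers the norm of [D]; it is 0 when [D] is 0, since the inverse of 0
   is 0. *)
set D := f t - f s; pose v := `|D|^-1 *: D.
have v1 : `|v| <= 1.
  rewrite normrZ ger0_norm ?invr_ge0//.
  by have [->|Dn0] := eqVneq `|D| 0; [rewrite mulr0|rewrite mulVf].
have vD : cmx_inner v D = `|D|.
  rewrite cmx_innerZl -frobenius_inner -normr_frobenius.
  by have [->|Dn0] := eqVneq `|D| 0; [rewrite expr0n mulr0|rewrite expr2 mulKf].
apply/ler_addgt0Pr => e e0.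
(* The bound [b <= 1] gives [b ^+ 3 <= b], and the second bound keeps the total error
   [b * (32 * c + (t - s))] below [e]. *)
pose b := Num.min 1 (e / (32 * c + (t - s))).
have b0 : 0 < b by rewrite lt_min ltr01 divr_gt0.
have b1 : b <= 1 by rewrite ge_min lexx.
have bK : b * (32 * c + (t - s)) <= e.
  by rewrite -ler_pdivlMr// ge_min lexx orbT.
have b3 : b ^+ 3 * (t - s) <= b * (t - s).
  rewrite ler_wpM2r ?subr_ge0 ?(ltW st)// exprS ler_piMr ?(ltW b0)//.
  by rewrite exprn_ile1 ?(ltW b0).
have E0 (A : cmx R d) : 0 <= energy A by exact: sqr_ge0.
have qs : 32 * c * (energy (f s) + b ^+ 4) `^ 4^-1 <=
    32 * c * (energy (f s) `^ 4^-1 + b).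
  by rewrite ler_pM2l ?mulr_gt0// powR_fourth_addX4 ?(ltW b0).
have qt : 32 * c * energy (f t) `^ 4^-1 <=
    32 * c * (energy (f t) + b ^+ 4) `^ 4^-1.
  by rewrite ler_pM2l ?mulr_gt0// ler_powR_fourth// E0 lerDl exprn_ge0 ?(ltW b0).
rewrite -vD /D cmx_innerDr -scaleN1r cmx_innerZr.
exact: ler_of_perturbed (curve_length_perturbed v1 b0 s0 st) qs qt bK b3.
Qed.

End Curve.

(** * Convergence at infinity *)

(** [p] is the difference of [p - psi] and [- psi], both nondecreasing and bounded above on the
    half-line. *)
Lemma cvg_dominated_increments (R : realType) (p psi : R -> R) :
  (forall t, 0 <= psi t) ->
  (forall s t, 0 <= s -> s <= t -> `|p t - p s| <= psi s - psi t) ->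
  cvg (p t @[t --> +oo]).
Proof.
(* Composing with [m] freezes a function at negative times, which makes it monotone on the whole
   line and leaves its limit at infinity unchanged. *)
move=> psi0 ppsi; pose m (t : R) := Num.max 0 t.
have m0 t : 0 <= m t by rewrite le_max lexx.
have mono s t : s <= t -> m s <= m t.
  by move=> st; rewrite ge_max m0 le_max st orbT.
have cvgm (u : R -> R) : nondecreasing_fun (u \o m) -> has_ubound (range (u \o m)) ->
    cvg (u t @[t --> +oo]).
  move=> und ub; apply/cvg_ex; exists (sup (range (u \o m))).
  have := nondecreasing_cvgr und ub; apply: cvg_trans; apply: near_eq_cvg.
  near=> t; rewrite /= /m max_r//; near: t; exact: nbhs_pinfty_ge.
have c1 : cvg ((p t - psi t) @[t --> +oo]).
  apply: (cvgm (fun t => p t - psi t)).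
    move=> s t /mono st /=; have := ppsi _ _ (m0 s) st.
    by rewrite ler_norml => /andP[]; lra.
  exists (p 0 + psi 0) => _ [t _ <-] /=; have := ppsi _ _ (lexx 0) (m0 t).
  by have := psi0 (m t); rewrite ler_norml => ? /andP[]; lra.
have c2 : cvg ((- psi t) @[t --> +oo]).
  apply: (cvgm (fun t => - psi t)).
    move=> s t /mono st /=; have := ppsi _ _ (m0 s) st.
    by have := normr_ge0 (p (m t) - p (m s)); lra.
  by exists 0 => _ [t _ <-] /=; rewrite oppr_le0.
have -> : p = (fun t => (p t - psi t) - (- psi t)).
  by apply/funext => t; rewrite opprK subrK.
exact: is_cvgB c1 c2.
Unshelve. all: by end_near. Qed.

(** The topology of [cmx] comes from the Frobenius norm, and the squared distance to the entrywise
    limit is a finite sum of squares that tend to 0. *)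
Lemma cmx_cvg (R : realType) (d : nat) (f : R -> cmx R d) (F : set_system R) :
  ProperFilter F ->
  (forall i j, cvg (complex.Re (f t i j) @[t --> F])) ->
  (forall i j, cvg (complex.Im (f t i j) @[t --> F])) ->
  cvg (f t @[t --> F]).
Proof.
move=> FF cRe cIm.
pose lr i j := lim (complex.Re (f t i j) @[t --> F]).
pose li i j := lim (complex.Im (f t i j) @[t --> F]).
pose L : cmx R d := \matrix_(i, j) ((lr i j) +i* (li i j))%C.
apply/cvg_ex; exists L.
have nE t : `|f t - L| ^+ 2 = \sum_i \sum_j ((complex.Re (f t i j) - lr i j) ^+ 2 +
    (complex.Im (f t i j) - li i j) ^+ 2).
  rewrite normr_frobenius frobenius_sqr; apply: eq_bigr => i _; apply: eq_bigr => j _.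
  by rewrite normc_sqr !mxE; case: (f t i j).
have cE : \sum_i \sum_j ((complex.Re (f t i j) - lr i j) ^+ 2 +
    (complex.Im (f t i j) - li i j) ^+ 2) @[t --> F] --> (0 : R).
  have z : \sum_(i < d) \sum_(j < d)
      ((lr i j - lr i j) ^+ 2 + (li i j - li i j) ^+ 2) = 0 :> R.
    by rewrite big1// => i _; rewrite big1// => j _; rewrite !subrr expr0n addr0.
  have cvg_sum (G : 'I_d -> R -> R) (l : 'I_d -> R) :
      (forall i, G i t @[t --> F] --> l i) -> \sum_i G i t @[t --> F] --> \sum_i l i.
    move=> h; exact: (@cvg_big R 'I_d +%R 0 xpredT (@add_continuous R) R F
      (index_enum 'I_d) G l _ (fun i _ => h i)).
  have centry i j : ((complex.Re (f t i j) - lr i j) ^+ 2 +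
      (complex.Im (f t i j) - li i j) ^+ 2) @[t --> F] -->
      (lr i j - lr i j) ^+ 2 + (li i j - li i j) ^+ 2.
    have sq (u : R -> R) (a : R) : u t @[t --> F] --> a ->
        (u t - a) ^+ 2 @[t --> F] --> (a - a) ^+ 2.
      move=> ua; under eq_cvg do rewrite expr2; rewrite expr2.
      by apply: cvgM; apply: cvgB => //; exact: cvg_cst.
    exact: (cvgD (sq _ _ (cRe i j)) (sq _ _ (cIm i j))).
  by have := cvg_sum _ _ (fun i => cvg_sum _ _ (centry i)); rewrite z.
apply/cvgrPdist_lt => e e0.
move/cvgrPdist_lt : cE => /(_ (e ^+ 2) (exprn_gt0 2 e0)).
apply: filterS => t; rewrite sub0r normrN -nE ger0_norm ?sqr_ge0//.
by rewrite ltr_sqr ?nnegrE ?(ltW e0)// distrC.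
Qed.

Lemma normr_Re_entry (R : realType) (d : nat) (A : cmx R d) i j :
  `|complex.Re (A i j)| <= `|A|.
Proof.
apply: le_trans (normc_le_norm A i j); case: (A i j) => a b /=.
by rewrite -sqrtr_sqr ler_wsqrtr// lerDl sqr_ge0.
Qed.

Lemma normr_Im_entry (R : realType) (d : nat) (A : cmx R d) i j :
  `|complex.Im (A i j)| <= `|A|.
Proof.
apply: le_trans (normc_le_norm A i j); case: (A i j) => a b /=.
by rewrite -sqrtr_sqr ler_wsqrtr// lerDr sqr_ge0.
Qed.

Unset Implicit Arguments.

Theorem proposition2p10 (R : realType) (d : nat) (hd : (1 <= d)%N)
    (F : cmx R d -> R -> cmx R d)
    (hF : is_negative_gradient_flow (@energy R d) F) :
  exists (epsilon c : R), 0 < epsilon /\ 0 < c /\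
    forall A0 : cmx R d, energy A0 < epsilon ->
      exists2 Ainf : cmx R d, F A0 t @[t --> +oo] --> Ainf &
        `|A0 - Ainf| <= 4 / c * energy A0 `^ (4^-1).
Proof.
pose c : R := 4 * d%:R ^+ 9.
have d1 : 1 <= d%:R ^+ 9 :> R by rewrite exprn_ege1// ler1n.
have c1 : 1 <= c by rewrite /c; lra.
have c0 : 0 < c by exact: lt_le_trans c1.
(* With this witness, 4 divided by it is the [32 * c] of [curve_length]. *)
exists 1, (8 * c)^-1; split=> //; split; first by rewrite invr_gt0 mulr_gt0.
move=> A0 _; have [F0 flow] := hF A0; pose f := F A0.
(* Uniqueness of gradients replaces the chosen value [gradient] by the explicit [energy_grad]. *)
have hf t : 0 <= t -> (s - t)^-1 *: (f s - f t) @[s --> within [set s | 0 <= s] t^']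
    --> - energy_grad (f t).
  by move=> t0; rewrite -(gradient_eq (is_gradient_energy (f t))); exact: flow.
have len := curve_length hf c1 (fun A => energy_lojasiewicz A hd).
pose psi t := 32 * c * energy (f t) `^ 4^-1.
have psi0 t : 0 <= psi t by rewrite mulr_ge0 ?powR_ge0// mulr_ge0 ?(ltW c0).
have incr (s t : R) : 0 <= s -> s <= t -> `|f t - f s| <= psi s - psi t.
  by move=> s0 st; rewrite -mulrBr; exact: len.
have cf : cvg (f t @[t --> +oo]).
  apply: cmx_cvg => i j; apply: (cvg_dominated_increments psi0) => s t s0 st;
    apply: le_trans (incr s t s0 st).
  - by apply: le_trans (normr_Re_entry _ i j); rewrite !mxE raddfB.
  - by apply: le_trans (normr_Im_entry _ i j); rewrite !mxE raddfB.
exists (lim (f t @[t --> +oo])) => //.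
(* The limit is approximated within [e] by [f t] at a large time [t], and the displacement up to [t]
   is at most [psi 0 - psi t], hence at most [psi 0]. *)
apply/ler_addgt0Pr => e e0.
have /cvgrPdist_lt/(_ _ e0) near_e := cf.
near (+oo : set_system R) => t.
have t0 : 0 <= t by near: t; exact: nbhs_pinfty_ge.
have -> : A0 - lim (f t @[t --> +oo]) = (f 0 - f t) + (f t - lim (f t @[t --> +oo])).
  by rewrite addrA subrK /f F0.
rewrite (le_trans (ler_normD _ _))// lerD//; last first.
  by rewrite distrC ltW//; near: t.
rewrite distrC (le_trans (incr 0 t (lexx 0) t0))//.
have -> : 4 / (8 * c)^-1 = 32 * c by rewrite invrK; ring.
by rewrite -{1}F0 lerBlDr lerDl; exact: psi0.
Unshelve. all: by end_near. Qed.
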